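(* Let $p$ be an odd prime, $n\ge 1$, $i\ge 1$. For $s\in\{0,1,\dots,n-1\}$ set $A_s:=P_{n,i,s}^{\,p}$ and $B:=R_{n,i}^{\,p}$. Then, for every integer $m\ge 1$, $$\delta_i^{\,m}(Q_{n,s})=B^{m}Q_{n,s}+B^{m-1}A_s$$ and $$(\mathrm{St}^{\Delta_i})^{m}(Q_{n,s})=(-1)^{mn}\,m!\,Q_{n,0}^{\,m}\big(B^{m}Q_{n,s}+B^{m-1}A_s\big),$$ where $m!$ is viewed as an element of $\mathbb{F}_p$.
   Context: Let $p$ be an odd prime, $n\ge 1$, $i\ge 1$, and $P_n=\mathbb{F}_p[x_1,\dots,x_n]$. For integers $e_1,\dots,e_n\ge 0$ put $[e_1,\dots,e_n]:=\det\big(x_r^{p^{e_s}}\big)_{1\le r,s\le n}\in P_n$. Let $L_n=[0,1,\dots,n-1]$ and $L_{n,s}=[0,1,\dots,\widehat{s},\dots,n]$ for $0\le s<n$ (a hat means omission). The Dickson invariants are $Q_{n,s}=L_{n,s}/L_n$ $(0\le s<n)$; in particular $Q_{n,0}=L_n^{p-1}$. The Dickson algebra is $D_n=P_n^{\mathrm{GL}_n(\mathbb{F}_p)}=\mathbb{F}_p[Q_{n,0},\dots,Q_{n,n-1}]$, a polynomial algebra on these generators. $\mathrm{St}^{\Delta_i}$ denotes the Steenrod--Milnor operation dual to the monomial $\xi_i$ in Milnor's dual mod-$p$ Steenrod algebra. It acts on $P_n$ as the unique $\mathbb{F}_p$-linear derivation with $\mathrm{St}^{\Delta_i}(x_r)=x_r^{p^i}$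 $(1\le r\le n)$, and it maps $D_n$ into $D_n$. On a localization of $D_n$, $\mathrm{St}^{\Delta_i}$ means the unique derivation extending $\mathrm{St}^{\Delta_i}|_{D_n}$. Set $P_{n,i,0}:=0$, $P_{n,i,s}:=-\dfrac{[0,1,\dots,\widehat{s-1},\dots,n-1,i-1]}{L_n}$ for $0<s<n$, and $R_{n,i}:=\dfrac{[0,1,\dots,n-2,i-1]}{L_n}$ (for $n=1$, $R_{1,i}=[i-1]/L_1$). These quotients lie in $D_n$. The normalized derivation is $\delta_i:=(-1)^nQ_{n,0}^{-1}\mathrm{St}^{\Delta_i}$ on $D_n[Q_{n,0}^{-1}]$; it maps $D_n$ into $D_n$. Powers of operators denote iterated composition. *)

(* Defs.v *)
From HB Require Import structures.
From mathcomp Require Import all_boot all_order all_algebra all_fingroup all_field.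
From mathcomp Require Import fraction generic_quotient ring.
From mathcomp.multinomials Require Import mpoly.

Set Implicit Arguments.
Unset Strict Implicit.
Unset Printing Implicit Defensive.

Import GRing.Theory.
Local Open Scope ring_scope.

Notation "x %:F" := (@FracField.tofrac _ x) : ring_scope.

(* The bracket [e_1, ..., e_n], meant for exponent sequences e of size n. *)
Definition bracket (p n : nat) (e : seq nat) : {mpoly 'F_p[n]} :=
  \det (\matrix_(r < n, s < n) ('X_r ^+ (p ^ nth 0%N e s)%N)).

Definition Ln (p n : nat) : {mpoly 'F_p[n]} := bracket p n (iota 0 n).

(* [rem s] plays the role of the hat over s, [rcons _ k] appends the last
   entry k of a bracket. *)
Definition Lns (p n s : nat) : {mpoly 'F_p[n]} :=
  bracket p n (rem s (iota 0 n.+1)).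

(* Quotients of brackets are formed in the fraction field of P_n, in which
   D_n and D_n[Q_{n,0}^-1] sit as subrings. *)
Definition dicksonQ (p n s : nat) : {fraction {mpoly 'F_p[n]}} :=
  (Lns p n s)%:F / (Ln p n)%:F.

Definition coefP (p n i s : nat) : {fraction {mpoly 'F_p[n]}} :=
  if s is s'.+1 then
    - ((bracket p n (rcons (rem s' (iota 0 n)) i.-1))%:F / (Ln p n)%:F)
  else 0.

Definition coefR (p n i : nat) : {fraction {mpoly 'F_p[n]}} :=
  (bracket p n (rcons (iota 0 n.-1) i.-1))%:F / (Ln p n)%:F.

Definition lin_subst (p n : nat) (A : 'M['F_p]_n) : n.-tuple {mpoly 'F_p[n]} :=
  [tuple \sum_(j < n) A r j *: 'X_j | r < n].

Definition in_dickson (p n : nat) (f : {mpoly 'F_p[n]}) : Prop :=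
  forall A : 'M['F_p]_n, A \in unitmx -> f \mPo (lin_subst A) = f.

Definition in_dickson_loc (p n : nat) (x : {fraction {mpoly 'F_p[n]}}) : Prop :=
  exists (f : {mpoly 'F_p[n]}) (k : nat),
    in_dickson f /\ x = f%:F / dicksonQ p n 0 ^+ k.

(* The derivation St^{Delta_i} of P_n; see [milnorP] for its characterization
   by the values on the variables. *)
Definition milnor (p n i : nat) (f : {mpoly 'F_p[n]}) : {mpoly 'F_p[n]} :=
  \sum_(r < n) 'X_r ^+ (p ^ i)%N * f^`M(r).

(* D restricts to a derivation of D_n[Q_{n,0}^-1] that extends the restriction
   of St^{Delta_i} to D_n. The values of D outside D_n[Q_{n,0}^-1] are
   irrelevant; on it, D exists and is unique ([milnor_extension_exists],
   [milnor_extension_unique]). *)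
Record milnor_extension (p n i : nat)
    (D : {fraction {mpoly 'F_p[n]}} -> {fraction {mpoly 'F_p[n]}}) : Prop :=
  MilnorExtension {
    milnor_ext_loc : forall x, in_dickson_loc x -> in_dickson_loc (D x);
    milnor_extD : forall x y, in_dickson_loc x -> in_dickson_loc y ->
      D (x + y) = D x + D y;
    milnor_extM : forall x y, in_dickson_loc x -> in_dickson_loc y ->
      D (x * y) = D x * y + x * D y;
    milnor_ext_dickson : forall f, in_dickson f -> D f%:F = (milnor i f)%:F
  }.

Definition delta (p n : nat)
    (D : {fraction {mpoly 'F_p[n]}} -> {fraction {mpoly 'F_p[n]}})
    (x : {fraction {mpoly 'F_p[n]}}) : {fraction {mpoly 'F_p[n]}} :=
  (-1) ^+ n * (dicksonQ p n 0)^-1 * D x.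

Lemma milnor_is_linear (p n i : nat) : linear (@milnor p n i).
Proof.
move=> c f g; rewrite /milnor scaler_sumr -big_split /=; apply: eq_bigr => r _.
by rewrite linearP /= mulrDr scalerAr.
Qed.

HB.instance Definition _ (p n i : nat) :=
  GRing.isLinear.Build 'F_p {mpoly 'F_p[n]} {mpoly 'F_p[n]} _
    (@milnor p n i) (@milnor_is_linear p n i).

Lemma milnorM (p n i : nat) (f g : {mpoly 'F_p[n]}) :
  milnor i (f * g) = milnor i f * g + f * milnor i g.
Proof.
rewrite /milnor mulr_suml mulr_sumr -big_split /=; apply: eq_bigr => r _.
by rewrite mderivM; ring.
Qed.

Lemma milnorX (p n i : nat) (r : 'I_n) :
  milnor i ('X_r : {mpoly 'F_p[n]}) = 'X_r ^+ (p ^ i)%N.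
Proof.
rewrite /milnor (bigD1 r) //= big1 => [|j j_neq_r]; rewrite mderivX mnm1E.
  have -> : (U_(r) - U_(r) = 0 :> 'X_{1.. n})%MM.
    by apply/mnmP => j; rewrite mnmBE subnn mnm0E.
  by rewrite eqxx scale1r mpolyX0 mulr1 addr0.
by rewrite eq_sym (negPf j_neq_r) scale0r mulr0.
Qed.

Lemma twisted_derivation_unique (p n : nat)
    (phi D E : {mpoly 'F_p[n]} -> {mpoly 'F_p[n]}) :
    phi 1 = 1 -> linear D -> linear E ->
    (forall f g, D (f * g) = D f * phi g + phi f * D g) ->
    (forall f g, E (f * g) = E f * phi g + phi f * E g) ->
    (forall r, D 'X_r = E 'X_r) -> D =1 E.
Proof.
move=> phi1 Dlin Elin DM EM DX.
have at0 (G : {mpoly 'F_p[n]} -> {mpoly 'F_p[n]}) : linear G -> G 0 = 0.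
  by move=> /(_ (-1) 0 0); rewrite scaleN1r oppr0 addr0 scaleN1r addNr.
have at1 (G : {mpoly 'F_p[n]} -> {mpoly 'F_p[n]}) :
    (forall f g, G (f * g) = G f * phi g + phi f * G g) -> G 1 = 0.
  move=> /(_ 1 1); rewrite phi1 !mulr1 mul1r => /eqP.
  by rewrite -subr_eq0 opprD addNKr oppr_eq0 => /eqP.
have prodP f g : D f = E f -> D g = E g -> D (f * g) = E (f * g).
  by move=> Df Dg; rewrite DM EM Df Dg.
have D1 : D 1 = E 1 by rewrite !at1.
elim/mpolyind => [|c m f _ _ IHf]; first by rewrite !at0.
rewrite Dlin Elin IHf; congr (_ *: _ + _); rewrite mpolyXE_id.
apply: (big_ind (fun f => D f = E f)) => // r _.
by elim: (m r) => [|k IHk]; rewrite ?expr0 // exprS; apply: prodP.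
Qed.

Lemma milnorP (p n i : nat) (D : {mpoly 'F_p[n]} -> {mpoly 'F_p[n]}) :
    linear D -> (forall f g, D (f * g) = D f * g + f * D g) ->
    (forall r, D 'X_r = 'X_r ^+ (p ^ i)%N) ->
  D =1 milnor i.
Proof.
move=> Dlin DM DX; apply: (@twisted_derivation_unique _ _ id) => //.
- exact: milnor_is_linear.
- exact: milnorM.
by move=> r; rewrite DX milnorX.
Qed.

Lemma expFp (p : nat) (c : 'F_p) : prime p -> c ^+ p = c.
Proof. by move=> p_pr; rewrite -[RHS]expf_card card_Fp. Qed.

Lemma exprp_lin (p n e : nat) (c : 'I_n -> 'F_p) : prime p ->
  (\sum_(j < n) c j *: 'X_j : {mpoly 'F_p[n]}) ^+ (p ^ e)%N =
  \sum_(j < n) c j *: 'X_j ^+ (p ^ e)%N.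
Proof.
move=> p_pr; have chp : p \in [pchar {mpoly 'F_p[n]}].
  by rewrite pchar_lalg pchar_Fp.
elim: e => [|e IHe]; first by rewrite expn0 expr1; under [RHS]eq_bigr do rewrite expr1.
rewrite expnSr exprM IHe -(pFrobenius_autE chp) rmorph_sum; apply: eq_bigr => j _.
by rewrite /= pFrobenius_autE exprZn exprM expFp.
Qed.

Lemma bracket_subst (p n : nat) (e : seq nat) (A : 'M['F_p]_n) : prime p ->
  bracket p n e \mPo lin_subst A = \det A *: bracket p n e.
Proof.
move=> p_pr; rewrite /bracket -det_map_mx -mul_mpolyC -det_map_mx -det_mulmx.
congr (\det _); apply/matrixP => r s; rewrite !mxE.
rewrite rmorphXn /= comp_mpolyXU -tnth_nth tnth_mktuple exprp_lin //.
by apply: eq_bigr => j _; rewrite !mxE mul_mpolyC.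
Qed.

Lemma Ln_neq0 (p n : nat) : prime p -> Ln p n != 0.
Proof.
move=> p_pr; pose m (s : 'S_n) : 'X_{1.. n} := [multinom (p ^ s r)%N | r < n].
suff Lm : (Ln p n)@_(m 1%g) = 1.
  by apply: contra_eq_neq Lm => ->; rewrite mcoeff0 eq_sym oner_eq0.
have termE (s : 'S_n) :
    (-1) ^+ s * \prod_r (\matrix_(r < n, s0 < n)
      ('X_r ^+ (p ^ nth 0%N (iota 0 n) s0)%N : {mpoly 'F_p[n]})) r (s r) =
    ((-1) ^+ s : 'F_p) *: 'X_[m s].
  rewrite -mul_mpolyC rmorphXn rmorphN rmorph1; congr (_ * _).
  rewrite mpolyXE_id; apply: eq_bigr => r _.
  by rewrite !mxE mnmE nth_iota.
rewrite /Ln /bracket /determinant (eq_bigr _ (fun s _ => termE s)).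
rewrite raddf_sum (bigD1 (1%g : 'S_n)) //= big1 => [|s s_neq1].
  by rewrite mcoeffZ mcoeffX eqxx odd_perm1 expr0 mulr1 addr0.
rewrite mcoeffZ mcoeffX; case: eqP => [ms1|]; last by rewrite mulr0.
case/eqP: s_neq1; apply/permP => r; apply/val_inj/eqP => /=.
have /eqP := congr1 (fun m0 : 'X_{1.. n} => m0 r) ms1.
by rewrite !mnmE eqn_exp2l ?prime_gt1.
Qed.

Lemma dicksonQ0E (p n : nat) : prime p ->
  dicksonQ p n 0 = (Ln p n ^+ p.-1)%:F.
Proof.
move=> p_pr; have chp : p \in [pchar {mpoly 'F_p[n]}].
  by rewrite pchar_lalg pchar_Fp.
have LE : Lns p n 0 = Ln p n ^+ p.
  rewrite /Lns -(pFrobenius_autE chp) -det_map_mx; congr (\det _).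
  apply/matrixP => r s; rewrite !mxE /= pFrobenius_autE -exprM -expnSr.
  by rewrite !nth_iota.
have L0 : (Ln p n)%:F != 0 by rewrite tofrac_eq0 Ln_neq0.
rewrite /dicksonQ; have -> : Lns p n 0 = Ln p n ^+ p.-1 * Ln p n.
  by rewrite LE -exprSr prednK ?prime_gt0.
by rewrite tofracM mulfK.
Qed.

Lemma Ln_dickson (p n : nat) : prime p -> in_dickson (Ln p n ^+ p.-1).
Proof.
move=> p_pr A; rewrite unitmxE unitfE => detA.
rewrite rmorphXn /= bracket_subst // exprZn.
suff -> : (\det A) ^+ p.-1 = 1 by rewrite scale1r.
apply: (mulfI detA); rewrite -exprS prednK ?prime_gt0 // mulr1.
by rewrite expFp.
Qed.

Lemma milnor_subst (p n i : nat) (f : {mpoly 'F_p[n]}) (A : 'M['F_p]_n) :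
  prime p -> milnor i (f \mPo lin_subst A) = milnor i f \mPo lin_subst A.
Proof.
move=> p_pr; pose phi (g : {mpoly 'F_p[n]}) := g \mPo lin_subst A.
apply: (@twisted_derivation_unique _ _ phi (fun g => milnor i (phi g))
  (fun g => phi (milnor i g))) => [|c g h|c g h|g h|g h|r]; rewrite /phi.
- exact: rmorph1.
- by rewrite linearP milnor_is_linear.
- by rewrite milnor_is_linear linearP.
- by rewrite rmorphM milnorM.
- by rewrite milnorM rmorphD !rmorphM.
rewrite milnorX rmorphXn /= comp_mpolyXU -tnth_nth tnth_mktuple exprp_lin //.
by rewrite linear_sum /=; apply: eq_bigr => j _; rewrite linearZ /= milnorX.
Qed.

Lemma milnor_dickson (p n i : nat) (f : {mpoly 'F_p[n]}) :
  prime p -> in_dickson f -> in_dickson (milnor i f).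
Proof. by move=> p_pr fD A Au; rewrite -milnor_subst ?fD. Qed.

Lemma milnor0 (p n i : nat) : milnor i (0 : {mpoly 'F_p[n]}) = 0.
Proof. exact: linear0. Qed.

Lemma in_dicksonM (p n : nat) (f g : {mpoly 'F_p[n]}) :
  in_dickson f -> in_dickson g -> in_dickson (f * g).
Proof. by move=> fD gD A Au; rewrite rmorphM /= fD ?gD. Qed.

Lemma in_dicksonB (p n : nat) (f g : {mpoly 'F_p[n]}) :
  in_dickson f -> in_dickson g -> in_dickson (f - g).
Proof. by move=> fD gD A Au; rewrite rmorphB /= fD ?gD. Qed.

Lemma in_dicksonX (p n k : nat) (f : {mpoly 'F_p[n]}) :
  in_dickson f -> in_dickson (f ^+ k).
Proof. by move=> fD A Au; rewrite rmorphXn /= fD. Qed.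

Lemma in_dickson_locF (p n : nat) (f : {mpoly 'F_p[n]}) :
  in_dickson f -> in_dickson_loc f%:F.
Proof. by move=> fD; exists f, 0%N; rewrite expr0 divr1. Qed.

Lemma fracE (R : idomainType) (x : {fraction R}) :
  {u : R * R | u.2 != 0 & x = u.1%:F / u.2%:F}.
Proof.
exists (frac (generic_quotient.repr x)); first exact: denom_ratioP.
have d0 : (\d_(generic_quotient.repr x))%:F != 0.
  by rewrite tofrac_eq0 denom_ratioP.
apply: (mulIf d0); rewrite divfK //.
move: (generic_quotient.reprK x); move: (generic_quotient.repr x) => r <-.
unlock FracField.tofrac; rewrite -[LHS]FracField.pi_mul.
apply/generic_quotient.eqmodP => /=.
rewrite FracField.equivfE /FracField.mulf.
by rewrite !numden_Ratio ?mulf_neq0 ?oner_neq0 ?denom_ratioP // !mulr1 mulrC.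
Qed.

Lemma quotient_rule_wd (F : fieldType) (a b f g da db df dg : F) :
    b != 0 -> g != 0 -> f * b = a * g ->
    df * b + f * db = da * g + a * dg ->
  (da * b - a * db) / b ^+ 2 = (df * g - f * dg) / g ^+ 2.
Proof.
move=> b0 g0 e1 e2.
have eA : a = f * b / g by rewrite e1 mulfK.
have -> : da = (df * b + f * db - a * dg) / g by rewrite e2 addrK mulfK.
by rewrite eA; field; rewrite b0 g0.
Qed.

Lemma cross_mul (F : fieldType) (a b f g : F) :
  b != 0 -> g != 0 -> f / g = a / b -> f * b = a * g.
Proof. by move=> b0 g0 /eqP; rewrite eqr_div // => /eqP. Qed.

Lemma quotient_ruleD (F : fieldType) (a b c e da db dc de : F) :
    b != 0 -> e != 0 ->
  ((da * e + a * de + (dc * b + c * db)) * (b * e)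
    - (a * e + c * b) * (db * e + b * de)) / (b * e) ^+ 2
  = (da * b - a * db) / b ^+ 2 + (dc * e - c * de) / e ^+ 2.
Proof. by move=> b0 e0; field; rewrite b0 e0. Qed.

Lemma quotient_ruleM (F : fieldType) (a b c e da db dc de : F) :
    b != 0 -> e != 0 ->
  ((da * c + a * dc) * (b * e) - a * c * (db * e + b * de)) / (b * e) ^+ 2
  = (da * b - a * db) / b ^+ 2 * (c / e) + a / b * ((dc * e - c * de) / e ^+ 2).
Proof. by move=> b0 e0; field; rewrite b0 e0. Qed.

(* The extension of a derivation to the fraction field by the quotient rule. *)
Definition frac_deriv (R : idomainType) (d : R -> R) (x : {fraction R}) :
    {fraction R} :=
  let u := sval (sig_of_sig2 (fracE x)) in
  ((d u.1)%:F * u.2%:F - u.1%:F * (d u.2)%:F) / u.2%:F ^+ 2.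

Section FracDeriv.

Variables (R : idomainType) (d : R -> R).
Hypothesis dD : forall f g, d (f + g) = d f + d g.
Hypothesis dM : forall f g, d (f * g) = d f * g + f * d g.

Lemma frac_derivE (f g : R) : g != 0 ->
  frac_deriv d (f%:F / g%:F) =
  ((d f)%:F * g%:F - f%:F * (d g)%:F) / g%:F ^+ 2.
Proof.
rewrite /frac_deriv; case: fracE => [[a b]] /= b0 eq_fg g0.
have bF : b%:F != 0 by rewrite tofrac_eq0.
have gF : g%:F != 0 by rewrite tofrac_eq0.
have FB_AG := cross_mul bF gF eq_fg.
have fb_ag : f * b = a * g.
  by apply/eqP; rewrite -tofrac_eq (tofracM f b) (tofracM a g); apply/eqP.
apply: quotient_rule_wd bF gF FB_AG _.
have := congr1 (fun h => (d h)%:F) fb_ag.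
by rewrite !dM !(tofracD, tofracM).
Qed.

Lemma frac_deriv_tofrac (f : R) : frac_deriv d f%:F = (d f)%:F.
Proof.
have d1 : d 1 = 0.
  have /eqP := dM 1 1.
  by rewrite !mulr1 mul1r -subr_eq0 opprD addNKr oppr_eq0 => /eqP.
rewrite -[f%:F]divr1 -(tofrac1 R) frac_derivE ?oner_neq0 //.
by rewrite d1 tofrac0 mulr0 subr0 tofrac1 expr1n divr1 mulr1.
Qed.

Lemma frac_derivD (x y : {fraction R}) :
  frac_deriv d (x + y) = frac_deriv d x + frac_deriv d y.
Proof.
have [[a b] /= b0 ->] := fracE x; have [[c e] /= e0 ->] := fracE y.
have bF : b%:F != 0 by rewrite tofrac_eq0.
have eF : e%:F != 0 by rewrite tofrac_eq0.
rewrite addf_div // -!tofracM -!tofracD !frac_derivE ?mulf_neq0 //.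
by rewrite !(dD, dM) !(tofracM, tofracD) quotient_ruleD.
Qed.

Lemma frac_derivM (x y : {fraction R}) :
  frac_deriv d (x * y) = frac_deriv d x * y + x * frac_deriv d y.
Proof.
have [[a b] /= b0 ->] := fracE x; have [[c e] /= e0 ->] := fracE y.
have bF : b%:F != 0 by rewrite tofrac_eq0.
have eF : e%:F != 0 by rewrite tofrac_eq0.
rewrite mulf_div -!tofracM !frac_derivE ?mulf_neq0 //.
by rewrite !dM !(tofracM, tofracD) quotient_ruleM.
Qed.

End FracDeriv.

Lemma milnor_extension_exists (p n i : nat) : prime p ->
  milnor_extension i (frac_deriv (@milnor p n i)).
Proof.
move=> p_pr; have mD (f g : {mpoly 'F_p[n]}) : milnor i (f + g) = milnor i f + milnor i g.
  exact: linearD.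
split=> [x|x y _ _|x y _ _|f _]; last 1 first.
- exact: (frac_deriv_tofrac (@milnorM p n i)).
- case=> f [k [fD ->]]; rewrite dicksonQ0E //.
  set q := Ln p n ^+ p.-1.
  have qD : in_dickson q by apply: Ln_dickson.
  have qk0 : q ^+ k != 0 by rewrite !expf_neq0 // Ln_neq0.
  exists (milnor i f * q ^+ k - f * milnor i (q ^+ k)), (k * 2)%N; split.
    by apply: in_dicksonB; apply: in_dicksonM => //;
       do ?apply: milnor_dickson => //; apply: in_dicksonX.
  rewrite dicksonQ0E // exprM -(tofracXn k q).
  rewrite (frac_derivE (@milnorM p n i)) //.
  rewrite (tofracB (milnor i f * q ^+ k)) (tofracM (milnor i f)) (tofracM f).
  by [].
- exact: (frac_derivD mD (@milnorM p n i) x y).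
- exact: (frac_derivM (@milnorM p n i) x y).
Qed.

Lemma milnor_extension_unique (p n i : nat)
    (D E : {fraction {mpoly 'F_p[n]}} -> {fraction {mpoly 'F_p[n]}}) :
    prime p -> milnor_extension i D -> milnor_extension i E ->
  forall x, in_dickson_loc x -> D x = E x.
Proof.
move=> p_pr [_ _ DM Df] [_ _ EM Ef] x xloc.
have [f [k [fD xE]]] := xloc.
pose q := (Ln p n ^+ p.-1) ^+ k.
have qD : in_dickson q by apply: in_dicksonX; apply: Ln_dickson.
have q0 : q%:F != 0 by rewrite tofrac_eq0 !expf_neq0 // Ln_neq0.
have fE : f%:F = x * q%:F.
  by rewrite xE dicksonQ0E // -(tofracXn k) divfK.
have qL := in_dickson_locF qD; apply: (mulIf q0).
apply: (@addIr _ (x * D q%:F)); rewrite -DM // (Df _ qD) -(Ef _ qD) -EM //.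
by rewrite -fE Df // Ef.
Qed.

(* Main.v *)
(** Every bracket entry x_r^(p^e) with e > 0 is a p-th power, hence killed by
    d = St^(Delta_i); so d[0, e_2, ..., e_n] = [i, e_2, ..., e_n] when the e_j
    are positive. Moving i to the last column and extracting a p-th root of the
    bracket identifies the result with a numerator of R_{n,i} or P_{n,i,s} and
    gives d Q_{n,s} = (-1)^n Q_{n,0} (B Q_{n,s} + A_s). Both A_s and B are p-th
    powers, hence constants of d, and A_0 = 0, so d Q_{n,0} = (-1)^n B Q_{n,0}^2;
    the two formulas follow by induction on m. *)

Require Import Defs.
From mathcomp Require Import all_boot all_order all_algebra.
From mathcomp Require Import fraction ring.
From mathcomp.multinomials Require Import mpoly.

Set Implicit Arguments.
Unset Strict Implicit.

Import GRing.Theory.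
Local Open Scope ring_scope.

(** * Derivations, powers and constants in characteristic p *)

Section Derivation.

Variables (R : comNzRingType) (d : R -> R).
Hypothesis dM : forall x y, d (x * y) = d x * y + x * d y.

Lemma derivation1 : d 1 = 0.
Proof.
have /eqP := dM 1 1.
by rewrite !mulr1 mul1r -subr_eq0 opprD addNKr oppr_eq0 => /eqP.
Qed.

Lemma derivationX (x : R) (k : nat) : d (x ^+ k) = k%:R * x ^+ k.-1 * d x.
Proof.
elim: k => [|k IHk]; first by rewrite expr0 derivation1 !mul0r.
rewrite exprS dM IHk; case: k {IHk} => [|k] /=; last by rewrite exprS; ring.
by rewrite !expr0; ring.
Qed.

Lemma derivation_exp_pchar (p : nat) (x : R) :
  p \in [pchar R] -> d (x ^+ p) = 0.
Proof. by move=> chp; rewrite derivationX pcharf0 // !mul0r. Qed.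

Lemma derivation_const_exp (x : R) (k : nat) : d x = 0 -> d (x ^+ k) = 0.
Proof. by move=> dx; rewrite derivationX dx mulr0. Qed.

End Derivation.

(** * Iterating a derivation on an affine expression in x *)

Section IteratedDerivation.

Variables (F : fieldType) (d : F -> F).
Hypothesis dD : forall x y, d (x + y) = d x + d y.
Hypothesis dM : forall x y, d (x * y) = d x * y + x * d y.

Variables (q x a b : F) (n : nat).
Hypothesis q_neq0 : q != 0.
Hypotheses (da : d a = 0) (db : d b = 0).
Hypothesis dq : d q = (-1) ^+ n * q * (b * q).
Hypothesis dx : d x = (-1) ^+ n * q * (b * x + a).

(** As [a] and [b] are constants, [d] acts on [x] alone; substituting d x raises both exponents of b
    by one. *)
Lemma derivation_affine (k : nat) :
  d (b ^+ k.+1 * x + b ^+ k * a) =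
  (-1) ^+ n * q * (b ^+ k.+2 * x + b ^+ k.+1 * a).
Proof.
rewrite dD !dM !(derivation_const_exp dM) // da dx !exprS; ring.
Qed.

(** Dividing by (-1)^n q after each derivation leaves no power of q to differentiate, so no
    factorial appears. *)
Lemma iter_normalized_derivation (k : nat) :
  iter k.+1 (fun y => (-1) ^+ n * q^-1 * d y) x = b ^+ k.+1 * x + b ^+ k * a.
Proof.
have cancel_sign y : (-1) ^+ n * q^-1 * ((-1) ^+ n * q * y) = y.
  by rewrite mulrA mulrACA -expr2 sqrr_sign mulVf // !mul1r.
elim: k => [|k IHk]; first by rewrite /= dx cancel_sign expr1 expr0 mul1r.
by rewrite iterS IHk derivation_affine cancel_sign.
Qed.

(** Put y_k = b^(k+1) x + b^k a, so b y_k = y_(k+1). In d(q^(k+1) y_k) the power of q contributes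
    k+1 copies of (-1)^n q^(k+2) y_(k+1) and y_k one more: this is the factor k+2 of the
    factorial. *)
Lemma iter_derivation (k : nat) :
  iter k.+1 d x =
  (-1) ^+ (k.+1 * n) * k.+1`!%:R * q ^+ k.+1 * (b ^+ k.+1 * x + b ^+ k * a).
Proof.
have d_nat j : d j%:R = 0.
  have d0 : d 0 = 0 by apply: (@addrI _ (d 0)); rewrite -dD !addr0.
  by elim: j => [|j IHj] //; rewrite -natr1 dD IHj (derivation1 dM) addr0.
have d_sign j : d ((-1) ^+ j) = 0.
  have dN1 : d (-1) = 0.
    by apply/(@addrI _ (d 1)); rewrite -dD subrr (d_nat 0) (derivation1 dM) addr0.
  exact: derivation_const_exp.
elim: k => [|k IHk]; first by rewrite /= dx mul1n mulr1 !expr1 expr0 mul1r.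
rewrite iterS IHk dM derivation_affine !dM d_sign d_nat (derivationX dM) dq.
rewrite [k.+2`!]factS natrM -[k.+2%:R]natr1 [(k.+2 * n)%N]mulSn exprD /= !exprS.
ring.
Qed.

End IteratedDerivation.

(** * Brackets: Frobenius shift, column expansions, derivative, invariance *)

Lemma map_rem_inj (T U : eqType) (f : T -> U) (x : T) (s : seq T) :
  injective f -> map f (rem x s) = rem (f x) (map f s).
Proof.
move=> f_inj; elim: s => //= y s IHs.
by rewrite (inj_eq f_inj); case: ifP => //= _; rewrite IHs.
Qed.

Section Brackets.

Variable p : nat.
Hypothesis p_pr : prime p.

Lemma pchar_mpolyFp (n : nat) : p \in [pchar {mpoly 'F_p[n]}].
Proof. by rewrite pchar_lalg pchar_Fp. Qed.

Lemma bracket_Frobenius (n : nat) (e : seq nat) : size e = n ->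
  bracket p n e ^+ p = bracket p n (map S e).
Proof.
move=> sz_e; rewrite /bracket -(pFrobenius_autE (pchar_mpolyFp n)) -det_map_mx.
congr (\det _); apply/matrixP => r s; rewrite !mxE /= pFrobenius_autE -exprM.
by rewrite -expnSr (nth_map 0%N) ?sz_e.
Qed.

(** The same minors serve the first-column and the last-column expansion. *)
Definition bracket_minor (n : nat) (e : seq nat) (r : 'I_n.+1) :
    {mpoly 'F_p[n.+1]} :=
  \det (\matrix_(j < n, s < n) 'X_(lift r j) ^+ (p ^ nth 0%N e s)%N).

Lemma bracket_cons (n k : nat) (e : seq nat) :
  bracket p n.+1 (k :: e) =
  \sum_(r < n.+1) 'X_r ^+ (p ^ k)%N * ((-1) ^+ r * bracket_minor e r).
Proof.
rewrite /bracket (expand_det_col _ ord0); apply: eq_bigr => r _.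
rewrite mxE /cofactor addn0; congr (_ * (_ * \det _)).
by apply/matrixP => j s; rewrite !mxE.
Qed.

(** The cofactor signs (-1)^(r+n) of the last column and (-1)^r of the first differ by (-1)^n, while
    the minors agree. *)
Lemma bracket_rcons (n k : nat) (e : seq nat) : size e = n ->
  bracket p n.+1 (rcons e k) = (-1) ^+ n * bracket p n.+1 (k :: e).
Proof.
move=> sz_e; rewrite bracket_cons mulr_sumr /bracket (expand_det_col _ ord_max).
apply: eq_bigr => r _; rewrite mxE /cofactor nth_rcons sz_e ltnn eqxx exprD.
suff -> : \det (row' r (col' ord_max (\matrix_(j < n.+1, s < n.+1)
    ('X_j ^+ (p ^ nth 0%N (rcons e k) s)%N : {mpoly 'F_p[n.+1]})))) =
    bracket_minor e r by rewrite /=; ring.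
congr (\det _); apply/matrixP => j s; rewrite !mxE /= /bump.
by rewrite leqNgt ltn_ord add0n nth_rcons sz_e ltn_ord.
Qed.

(** All remaining exponents being positive, each first-column minor is a p-th power by Frobenius,
    hence a constant; only the entry x_r is differentiated. *)
Lemma milnor_bracket (n i : nat) (e : seq nat) : size e = n ->
  milnor i (bracket p n.+1 (0%N :: map S e)) = bracket p n.+1 (i :: map S e).
Proof.
move=> sz_e; rewrite !bracket_cons linear_sum; apply: eq_bigr => r _ /=.
have mM := @milnorM p n.+1 i.
have minorE : bracket_minor (map S e) r = bracket_minor e r ^+ p.
  rewrite /bracket_minor -(pFrobenius_autE (pchar_mpolyFp _)) -det_map_mx.
  congr (\det _); apply/matrixP => j s; rewrite !mxE /= pFrobenius_autE -exprM.
  by rewrite -expnSr (nth_map 0%N) ?sz_e.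
have d_sign : milnor i ((-1) ^+ r : {mpoly 'F_p[n.+1]}) = 0.
  apply: (derivation_const_exp mM).
  by rewrite linearN /= (derivation1 mM) oppr0.
rewrite expr1 !mM minorE (derivation_exp_pchar mM _ (pchar_mpolyFp _)) d_sign.
by rewrite milnorX mul0r mulr0 addr0 mulr0 addr0.
Qed.

Lemma bracket_quotient_loc (n : nat) (e : seq nat) :
  in_dickson_loc ((bracket p n e)%:F / (Ln p n)%:F).
Proof.
have p2E : p.-2.+1 = p.-1 by rewrite prednK // -subn1 subn_gt0 prime_gt1.
(* Each bracket is det-semi-invariant, so L_n^(p-2) completes the numerator to
   total weight det^(p-1) = 1 and the denominator to L_n^(p-1) = Q_{n,0}. *)
exists (bracket p n e * Ln p n ^+ p.-2), 1%N; split=> [A|].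
  rewrite unitmxE unitfE => detA.
  have eE := bracket_subst e A p_pr.
  have LE : Ln p n \mPo lin_subst A = \det A *: Ln p n by apply: bracket_subst.
  move: (bracket p n e) (Ln p n) eE LE => f L eE LE.
  rewrite rmorphM rmorphXn /= eE LE.
  rewrite exprZn -scalerAl -scalerAr scalerA -exprS.
  suff -> : \det A ^+ p.-2.+1 = 1 by rewrite scale1r.
  apply: (mulfI detA); rewrite -exprS mulr1 p2E prednK ?prime_gt0 //.
  exact: expFp.
rewrite expr1 dicksonQ0E //; move: p2E; move: p.-1 p.-2 => k j <-.
have Lj0 : (Ln p n ^+ j)%:F != 0 :> {fraction {mpoly 'F_p[n]}}.
  by rewrite tofrac_eq0 expf_neq0 // Ln_neq0.
move: (bracket p n e) (Ln p n) Lj0 => f L Lj0.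
by rewrite exprS (tofracM f) (tofracM L) -mulf_div divff ?mulr1.
Qed.

End Brackets.

(** * Field identities for the quotient rule and its signs *)

Section FieldIdentities.

Variable K : fieldType.

Lemma quotient_rule_div (x y dx dy u v : K) :
    y != 0 -> dx / y = u -> dy / y = v ->
  (dx * y - x * dy) / y ^+ 2 = u - x / y * v.
Proof. by move=> y0 <- <-; field. Qed.

(** For l = L_n the factor l^(p-1) is Q_{n,0}, and the bracket quotient appears as a full p-th
    power. *)
Lemma sign_exp_div (p : nat) (sg f l : K) : (0 < p)%N -> l != 0 ->
  sg * f ^+ p / l = sg * l ^+ p.-1 * (f / l) ^+ p.
Proof.
case: p => // k _ l0; rewrite succnK expr_div_n [l ^+ k.+1]exprSr.
by field; rewrite l0 expf_neq0.
Qed.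

(** Carries the minus sign of P_{n,i,s} through the p-th power; oddness of p enters here. *)
Lemma oppr_exp_odd (k : nat) (x : K) : odd k -> (- x) ^+ k = - x ^+ k.
Proof. by move=> k_odd; rewrite exprNn -signr_odd k_odd expr1 mulN1r. Qed.

Lemma dicksonQ_derivative_identity (sg q x a b : K) :
  sg * q * - a - x * (sg * q * b) = -1 * sg * q * (b * x + a).
Proof. by ring. Qed.

End FieldIdentities.

(** * The derivative of a Dickson invariant, in n+1 variables *)

Section DicksonDerivative.

Variables (p n i : nat).
Hypotheses (p_pr : prime p) (p_odd : odd p) (i_gt0 : (0 < i)%N).

Let F := {fraction {mpoly 'F_p[n.+1]}}.
Let E : F -> F := frac_deriv (@milnor p n.+1 i).

(** Moving i to the last of n+1 columns costs (-1)^n. As i > 0, every exponent is a successor, so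
    Frobenius gives the p-th root. *)
Lemma bracket_cons_Frobenius (e : seq nat) : size e = n ->
  bracket p n.+1 (i :: map S e) = (-1) ^+ n * bracket p n.+1 (rcons e i.-1) ^+ p.
Proof.
move=> sz_e; rewrite bracket_Frobenius ?size_rcons ?sz_e // map_rcons.
by rewrite prednK // bracket_rcons ?size_map // mulrA -expr2 sqrr_sign mul1r.
Qed.

Lemma milnor_bracket_quotient (e : seq nat) : size e = n ->
  (milnor i (bracket p n.+1 (0%N :: map S e)))%:F / (Ln p n.+1)%:F =
  (-1) ^+ n * dicksonQ p n.+1 0 *
  ((bracket p n.+1 (rcons e i.-1))%:F / (Ln p n.+1)%:F) ^+ p.
Proof.
move=> sz_e; have L0 : (Ln p n.+1)%:F != 0 :> F by rewrite tofrac_eq0 Ln_neq0.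
rewrite milnor_bracket // bracket_cons_Frobenius // dicksonQ0E //.
move: (bracket p n.+1 _) => f; rewrite tofracM !tofracXn rmorphN rmorph1.
by rewrite sign_exp_div // prime_gt0.
Qed.

Lemma milnor_Ln :
  (milnor i (Ln p n.+1))%:F / (Ln p n.+1)%:F =
  (-1) ^+ n * dicksonQ p n.+1 0 * coefR p n.+1 i ^+ p.
Proof.
rewrite /coefR -(milnor_bracket_quotient (size_iota 0 n)).
by rewrite -(iotaDl 1).
Qed.

Lemma milnor_Lns (s : nat) : (s < n.+1)%N ->
  (milnor i (Lns p n.+1 s))%:F / (Ln p n.+1)%:F =
  (-1) ^+ n * dicksonQ p n.+1 0 * - coefP p n.+1 i s ^+ p.
Proof.
case: s => [_|s s_lt_n].
  (* Omitting 0 leaves the shift of 0, ..., n: a p-th power, killed by the derivation, in accordance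
     with P_{n,i,0} = 0. *)
  have LnsE : Lns p n.+1 0 = Ln p n.+1 ^+ p.
    by rewrite (bracket_Frobenius p_pr (size_iota 0 n.+1)) -[map _ _](iotaDl 1 0).
  have -> : milnor i (Lns p n.+1 0) = 0.
    have mM := @milnorM p n.+1 i.
    by rewrite LnsE (derivation_exp_pchar mM _ (pchar_mpolyFp p_pr n.+1)).
  have -> : coefP p n.+1 i 0 ^+ p = 0.
    by rewrite /coefP expr0n -[p == 0%N]negbK -lt0n prime_gt0.
  by rewrite tofrac0 mul0r oppr0 mulr0.
have sz_e : size (rem s (iota 0 n.+1)) = n.
  by rewrite size_rem ?size_iota ?mem_iota //= ltnW.
(* The entry 0 survives, and lowering the tail by one moves the hat from s+1 to s, which is the
   index shift in [coefP]. *)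
have LnsE : rem s.+1 (iota 0 n.+2) = 0%N :: map S (rem s (iota 0 n.+1)).
  by rewrite (map_rem_inj _ _ succn_inj) -[map _ _](iotaDl 1 0).
rewrite /Lns LnsE milnor_bracket_quotient //.
by rewrite /coefP (oppr_exp_odd (_ / _) p_odd) opprK.
Qed.

Lemma frac_deriv_dicksonQ (s : nat) : (s < n.+1)%N ->
  E (dicksonQ p n.+1 s) = (-1) ^+ n.+1 * dicksonQ p n.+1 0 *
    (coefR p n.+1 i ^+ p * dicksonQ p n.+1 s + coefP p n.+1 i s ^+ p).
Proof.
move=> s_lt_n; have mM := @milnorM p n.+1 i.
have L0 : (Ln p n.+1)%:F != 0 :> F by rewrite tofrac_eq0 Ln_neq0.
rewrite [in LHS]/dicksonQ /E (frac_derivE mM) ?Ln_neq0 //.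
rewrite (quotient_rule_div _ L0 (milnor_Lns s_lt_n) milnor_Ln).
rewrite -/(dicksonQ p n.+1 s) [_ ^+ n.+1]exprS; exact: dicksonQ_derivative_identity.
Qed.

End DicksonDerivative.

(** * Stability of the localization and transfer of iterates *)

Lemma in_dickson_loc_dicksonQ (p n s : nat) : prime p ->
  in_dickson_loc (dicksonQ p n s).
Proof. by move=> p_pr; apply: bracket_quotient_loc. Qed.

Lemma in_dickson_loc_delta (p n i : nat)
    (D : {fraction {mpoly 'F_p[n]}} -> {fraction {mpoly 'F_p[n]}}) x :
  milnor_extension i D -> in_dickson_loc x -> in_dickson_loc (delta D x).
Proof.
move=> D_ext /(milnor_ext_loc D_ext) [f [k [fD Dx]]].
(* The sign joins the numerator, and Q_{n,0}^-1 adds one to the denominator exponent. *)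
exists ((-1) ^+ n * f), k.+1; split.
  by move=> A Au; rewrite rmorphM rmorphXn rmorphN rmorph1 /= fD.
have sgE : ((-1) ^+ n * f)%:F = (-1) ^+ n * f%:F.
  by rewrite tofracM tofracXn rmorphN rmorph1.
by rewrite /delta Dx mulf_div sgE exprS.
Qed.

(** Stability of P keeps the whole orbit where the two maps agree. *)
Lemma eq_iter_in (T : Type) (P : T -> Prop) (f g : T -> T) (m : nat) (x : T) :
    (forall y, P y -> P (f y)) -> (forall y, P y -> f y = g y) -> P x ->
  iter m f x = iter m g x.
Proof.
move=> Pf eq_fg Px; suff [] : P (iter m f x) /\ iter m f x = iter m g x by [].
elim: m => [|m [Pm IHm]] //=; split; first exact: Pf.
by rewrite -IHm eq_fg.
Qed.

Unset Implicit Arguments.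

Theorem theorem2p11 (p n i : nat) (p_pr : prime p) (p_odd : odd p)
    (n_gt0 : (0 < n)%N) (i_gt0 : (0 < i)%N)
    (St : {fraction {mpoly 'F_p[n]}} -> {fraction {mpoly 'F_p[n]}})
    (St_ext : milnor_extension i St)
    (s m : nat) (s_lt_n : (s < n)%N) (m_gt0 : (0 < m)%N) :
  let A := coefP p n i s ^+ p in
  let B := coefR p n i ^+ p in
  iter m (delta St) (dicksonQ p n s)
    = B ^+ m * dicksonQ p n s + B ^+ m.-1 * A
  /\ iter m St (dicksonQ p n s)
    = (-1) ^+ (m * n) * m`!%:R * dicksonQ p n 0 ^+ m
      * (B ^+ m * dicksonQ p n s + B ^+ m.-1 * A).
Proof.
case: n n_gt0 St St_ext s_lt_n => // n _ St St_ext s_lt_n A B.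
case: m m_gt0 => // m _; rewrite succnK.
pose F := {fraction {mpoly 'F_p[n.+1]}}.
(* [St] is controlled only on the localization, so the computation uses the quotient-rule extension,
   a derivation of the whole field; uniqueness then transfers it to [St]. *)
pose E : F -> F := frac_deriv (@milnor p n.+1 i).
have mM := @milnorM p n.+1 i.
have ED (x y : F) : E (x + y) = E x + E y.
  by apply: (frac_derivD _ mM) => f g; apply: linearD.
have EM (x y : F) : E (x * y) = E x * y + x * E y by apply: (frac_derivM mM).
have chF : p \in [pchar F] :=
  rmorph_pchar (@tofrac {mpoly 'F_p[n.+1]}) (pchar_mpolyFp p_pr n.+1).
have EA : E A = 0 by rewrite /A (derivation_exp_pchar EM _ chF).
have EB : E B = 0 by rewrite /B (derivation_exp_pchar EM _ chF).
have q0 : dicksonQ p n.+1 0 != 0.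
  by rewrite dicksonQ0E // tofrac_eq0 expf_neq0 // Ln_neq0.
have coefP0 : coefP p n.+1 i 0 ^+ p = 0.
  by rewrite /coefP expr0n -[p == 0%N]negbK -lt0n prime_gt0.
have Eq := frac_deriv_dicksonQ p_pr p_odd i_gt0 (ltn0Sn n).
have {}Eq : E (dicksonQ p n.+1 0) =
    (-1) ^+ n.+1 * dicksonQ p n.+1 0 * (B * dicksonQ p n.+1 0).
  by rewrite /E Eq coefP0 addr0.
have Ex := frac_deriv_dicksonQ p_pr p_odd i_gt0 s_lt_n.
have Qloc := in_dickson_loc_dicksonQ n.+1 s p_pr.
have StE x : in_dickson_loc x -> St x = E x.
  exact: milnor_extension_unique p_pr St_ext (milnor_extension_exists _ _ p_pr) x.
split.
- rewrite -(iter_normalized_derivation ED EM q0 EA EB Ex).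
  apply: eq_iter_in Qloc => x xloc; last by rewrite /delta StE.
  exact: in_dickson_loc_delta St_ext xloc.
- rewrite -(iter_derivation ED EM EA EB Eq Ex).
  apply: eq_iter_in Qloc => x xloc; last exact: StE.
  exact: milnor_ext_loc St_ext x xloc.
Qed.
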